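(* Let $\Lambda=K\Gamma/I$ with Jacobson radical $J$, and let $U$ be a non-simple uniserial left $\Lambda$-module with mast $p$, where $p$ does not start with an oriented cycle. If the radical embedding $JU\hookrightarrow U$ is irreducible, then (i) all detours on $p$ are inessential; (ii) all non-routes on $p$ are in $Jp$ (as elements of $\Lambda$). In particular, $U\cong\Lambda e/Jp$ with $e=\mathrm{s}(p)$.
   Context: $K$ is a field, $\Gamma$ a finite quiver (oriented cycles are allowed), $I$ an admissible ideal of $K\Gamma$, and $\Lambda=K\Gamma/I$ is finite-dimensional; modules are finitely generated left modules. Paths are composed from right to left; $\mathrm{s}(p)$ is the starting point of $p$. Vertices and paths are identified with their classes in $\Lambda$ where useful. A module is uniserial if it has only one composition series with simple factors. If $U$ is uniserial of length $n$, a mast of $U$ is a path $p$ in $\Gamma$ of length $n-1$ such that $px\neq0$ for some $x\in U$. A path $u$ is a right subpath of $p$ if $p=ru$ for some path $r$. ''$p$ does not start with an oriented cycle'' means that no right subpath of $p$ of positive length is an oriented cycle. A detour on $p$ is a pair $(\alpha,u)$ with $\alpha$ an arrow and $u$ a right subpath of $p$, where $\alpha u$ is a path in $\Gamma$ which is not a right subpath of $p$, but there exists a right subpath $v$ of $p$ with $\operatorname{length}(v)\ge\operatorname{length}(u)+1$ whose endpoint coincides with the endpoint of $\alpha$. For a detour $(\alpha,u)$ on $p$, let $\{v_i(\alpha,u)\mid i\in I(\alpha,u)\}$ be the family of right subpaths of $p$ in $K\Gamma$ which are longer than $u$ and have the same endpoint as $\alpha$. If $p$ has length $l$ and passes consecutively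 through vertices $e(1),\dots,e(l+1)$ (not necessarily distinct), a route on $p$ is a path in $\Gamma$ which starts in $e(1)$ and passes through a subsequence of the sequence $(e(1),\dots,e(l+1))$ in this order and through no other vertices; a non-route on $p$ is a path in $\Gamma$ which starts in $e(1)$ and is not a route on $p$. A detour $(\alpha,u)$ on $p$ is inessential if in $\Lambda$ one has $\alpha u=s+\sum_{i\in I(\alpha,u)}k_iv_i(\alpha,u)$, where $s$ is a $K$-linear combination of paths none of which is a route on $p$, and $k_i\in K$ for all $i$. A map $f$ of finitely generated modules is irreducible if it is neither a split monomorphism nor a split epimorphism and $f=gh$ implies that $h$ is a split monomorphism or $g$ is a split epimorphism. *)

(* Defs.v *)
From HB Require Import structures.
From mathcomp Require Import all_boot all_algebra.
From mathcomp Require Import finmap boolp.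
From mathcomp Require Import monalg.

Set Implicit Arguments.
Unset Strict Implicit.
Unset Printing Implicit Defensive.

Set Warnings "-redundant-canonical-projection".

Import GRing.Theory.

Local Open Scope ring_scope.
Local Open Scope quotient_scope.

Definition submodule_type (R : pzRingType) (M : lmodType R)
  (S : submodClosed M) : Type := {x : M | x \in S}.

Section SubmoduleType.
Variables (R : pzRingType) (M : lmodType R) (S : submodClosed M).
HB.instance Definition _ := SubChoice.on (submodule_type S).
HB.instance Definition _ :=
  [SubChoice_isSubLmodule of submodule_type S by <:].

Definition submodule_incl : {linear submodule_type S -> M} :=
  (val : submodule_type S -> M).

(* S :&: T, seen inside S *)
Definition submodule_trace (T : submodClosed M) : {pred submodule_type S} :=
  [pred x | val x \in T].

Fact submodule_trace_closed (T : submodClosed M) :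
  subsemimod_closed (submodule_trace T).
Proof.
split; first split=> [|x y].
- by rewrite inE raddf0 rpred0.
- by rewrite !inE raddfD => Tx Ty; rewrite rpredD.
- by move=> a x; rewrite !inE linearZ => Tx; rewrite rpredZ.
Qed.

HB.instance Definition _ (T : submodClosed M) :=
  GRing.isSubmodClosed.Build R (submodule_type S) (submodule_trace T)
    (submodule_trace_closed T).

End SubmoduleType.

Arguments submodule_incl {R M} S.
Arguments submodule_trace {R M} S T.

(* S as an additive subgroup: Quotient.quot expects a zmodClosed. *)
Definition submodule_subgroup (R : pzRingType) (M : lmodType R)
  (S : submodClosed M) : {pred M} := S.

Fact submodule_subgroup_closed (R : pzRingType) (M : lmodType R)
  (S : submodClosed M) : zmod_closed (submodule_subgroup S).
Proof. exact: GRing.subsemimod_closedB (GRing.subsemimodClosedP S). Qed.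

HB.instance Definition _ (R : pzRingType) (M : lmodType R)
    (S : submodClosed M) :=
  GRing.isZmodClosed.Build M (submodule_subgroup S)
    (submodule_subgroup_closed S).

Definition quotient_module (R : pzRingType) (M : lmodType R)
  (S : submodClosed M) : Type := Quotient.quot (submodule_subgroup S).

Section QuotientModule.
Variables (R : pzRingType) (M : lmodType R) (S : submodClosed M).
Local Notation Q := (Quotient.quot (submodule_subgroup S)).

HB.instance Definition _ := GRing.Zmodule.on (quotient_module S).

Definition quotient_scale (a : R) : Q -> Q := fun x => \pi_Q (a *: repr x).

Lemma quotient_scaleE a (x : M) :
  quotient_scale a (\pi_Q x) = \pi_Q (a *: x).
Proof.
apply/eqP; rewrite -Quotient.idealrBE -scalerBr; apply: (rpredZ a (x := _ - x)).
change (repr (\pi_Q x) - x \in submodule_subgroup S).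
by rewrite Quotient.idealrBE reprK.
Qed.

Fact quotient_scaleA a b x :
  quotient_scale a (quotient_scale b x) = quotient_scale (a * b) x.
Proof.
by rewrite -[x]reprK (quotient_scaleE b) (quotient_scaleE a) scalerA
  quotient_scaleE.
Qed.

Fact quotient_scale1 : left_id 1 quotient_scale.
Proof. by move=> x; rewrite -[x]reprK quotient_scaleE scale1r. Qed.

Fact quotient_scaleDr : right_distributive quotient_scale +%R.
Proof.
move=> a x y; rewrite -[x]reprK -[y]reprK -raddfD !quotient_scaleE.
by rewrite scalerDr raddfD.
Qed.

Fact quotient_scaleDl (x : Q) : {morph quotient_scale^~ x : a b / a + b}.
Proof.
by move=> a b; rewrite -[x]reprK !quotient_scaleE scalerDl raddfD.
Qed.

HB.instance Definition _ := GRing.Zmodule_isLmodule.Build R (quotient_module S)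
  quotient_scaleA quotient_scale1 quotient_scaleDr quotient_scaleDl.

End QuotientModule.

Section ModuleNotions.
Variable R : pzRingType.

Definition finitely_generated (M : lmodType R) : Prop :=
  exists (n : nat) (g : 'I_n -> M), forall x : M,
    exists a : 'I_n -> R, x = \sum_i a i *: g i.

Definition simple_module (M : lmodType R) : Prop :=
  (exists x : M, x != 0) /\
  forall S : submodClosed M,
    (forall x, x \in S -> x = 0) \/ (forall x, x \in S).

Definition isomorphic_modules (M N : lmodType R) : Prop :=
  exists f : {linear M -> N}, bijective f.

(* 0 = c 0 <= c 1 <= ... <= c n = M with simple factors; the values c i for
   i > n are irrelevant. *)
Definition composition_series (M : lmodType R) (n : nat)
    (c : nat -> submodClosed M) : Prop :=
  [/\ forall x, (x \in c 0%N) = (x == 0),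
      forall x, x \in c n
    & forall i, (i < n)%N -> {subset c i <= c i.+1} /\
        simple_module (quotient_module (submodule_trace (c i.+1) (c i)))].

Definition has_length (M : lmodType R) (n : nat) : Prop :=
  exists c, @composition_series M n c.

Definition uniserial (M : lmodType R) : Prop :=
  exists n c, @composition_series M n c /\
    forall n' c', composition_series n' c' ->
      n' = n /\ forall i, (i <= n)%N -> c' i =i c i.

Definition split_mono (M N : lmodType R) (f : {linear M -> N}) : Prop :=
  exists g : {linear N -> M}, forall x, g (f x) = x.

Definition split_epi (M N : lmodType R) (f : {linear M -> N}) : Prop :=
  exists g : {linear N -> M}, forall y, f (g y) = y.

Definition irreducible_map (M N : lmodType R) (f : {linear M -> N}) : Prop :=
  [/\ ~ split_mono f, ~ split_epi f
    & forall (X : lmodType R) (g : {linear X -> N}) (h : {linear M -> X}),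
        finitely_generated X -> (forall x, f x = g (h x)) ->
        split_mono h \/ split_epi g].

(* Left ideals of R are the submodules of the regular module R^o. *)
Definition maximal_left_ideal (m : submodClosed R^o) : Prop :=
  1 \notin m /\
  forall n : submodClosed R^o, {subset m <= n} -> 1 \notin n ->
    {subset n <= m}.

Definition jacobson_radical : {pred R^o} :=
  [pred x | `[< forall m, maximal_left_ideal m -> x \in m >]].

Fact jacobson_radical_closed : subsemimod_closed jacobson_radical.
Proof.
split; first split=> [|x y].
- by rewrite inE; apply/asboolP => m _; rewrite rpred0.
- rewrite !inE => /asboolP Jx /asboolP Jy; apply/asboolP => m mm.
  by rewrite rpredD ?Jx ?Jy.
- move=> a x; rewrite !inE => /asboolP Jx; apply/asboolP => m mm.
  by rewrite rpredZ ?Jx.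
Qed.

HB.instance Definition _ := GRing.isSubmodClosed.Build R R^o jacobson_radical
  jacobson_radical_closed.

(* A x = {a x | a \in A}, for a left ideal A of R and an element x of M *)
Definition ideal_mul (A : submodClosed R^o) (M : lmodType R) (x : M) :
    {pred M} :=
  [pred y | `[< exists2 a : R, a \in A & y = a *: x >]].

Fact ideal_mul_closed A M x : subsemimod_closed (@ideal_mul A M x).
Proof.
split; first split=> [|y z].
- by rewrite inE; apply/asboolP; exists 0; rewrite ?scale0r //; exact: (rpred0 A).
- rewrite !inE => /asboolP[a Aa ->] /asboolP[b Ab ->]; apply/asboolP.
  by exists (a + b); [exact: (rpredD Aa Ab) | rewrite scalerDl].
- move=> c y; rewrite !inE => /asboolP[a Aa ->]; apply/asboolP.
  by exists (c * a); [exact: (rpredZ c Aa) | rewrite scalerA].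
Qed.

HB.instance Definition _ A M x := GRing.isSubmodClosed.Build R M
  (@ideal_mul A M x) (@ideal_mul_closed A M x).

(* J M: the finite sums of products a x with a in J and x in M *)
Definition radical_module (M : lmodType R) : {pred M} :=
  [pred y | `[< exists (n : nat) (a : 'I_n -> R) (x : 'I_n -> M),
      (forall i, a i \in jacobson_radical) /\ y = \sum_i a i *: x i >]].

Fact radical_module_closed M : subsemimod_closed (@radical_module M).
Proof.
split; first split=> [|y z].
- rewrite inE; apply/asboolP; exists 0%N, (fun=> 0), (fun=> 0).
  by split=> [[]//|]; rewrite big_ord0.
- rewrite !inE => /asboolP[n [a [x [Ja ->]]]] /asboolP[m [b [z' [Jb ->]]]].
  apply/asboolP; exists (n + m)%N.
  exists (fun i => match split i with inl j => a j | inr j => b j end).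
  exists (fun i => match split i with inl j => x j | inr j => z' j end).
  split=> [i|]; first by case: (split i).
  rewrite big_split_ord /=; congr (_ + _); apply: eq_bigr => i _.
    by rewrite (unsplitK (inl i)).
  by rewrite (unsplitK (inr i)).
- move=> c y; rewrite !inE => /asboolP[n [a [x [Ja ->]]]]; apply/asboolP.
  exists n, (fun i => c * a i), x; split=> [i|].
    exact: (rpredZ c (Ja i)).
  by rewrite scaler_sumr; apply: eq_bigr => i _; rewrite scalerA.
Qed.

HB.instance Definition _ M := GRing.isSubmodClosed.Build R M
  (@radical_module M) (@radical_module_closed M).

End ModuleNotions.

Definition whole_ring (R : pzRingType) : {pred R^o} := predT.

Fact whole_ring_closed R : subsemimod_closed (@whole_ring R).
Proof. by []. Qed.

HB.instance Definition _ R := GRing.isSubmodClosed.Build R R^o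
  (@whole_ring R) (@whole_ring_closed R).

Record two_sided_ideal (R : pzRingType) := TwoSidedIdeal {
  two_sided_pred :> zmodClosed R;
  two_sided_mull : forall a x, x \in two_sided_pred -> a * x \in two_sided_pred;
  two_sided_mulr : forall a x, x \in two_sided_pred -> x * a \in two_sided_pred
}.

Definition quotient_ring (R : pzRingType) (I : two_sided_ideal R) : Type :=
  Quotient.quot I.

Section QuotientRing.
Variables (R : pzRingType) (I : two_sided_ideal R).
Local Notation Q := (Quotient.quot I).

HB.instance Definition _ := GRing.Zmodule.on (quotient_ring I).

Definition quotient_mul (x y : Q) : Q := \pi_Q (repr x * repr y).

Lemma quotient_mulE (x y : R) :
  quotient_mul (\pi_Q x) (\pi_Q y) = \pi_Q (x * y).
Proof.
apply/eqP; rewrite -Quotient.idealrBE.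
set x' := repr _; set y' := repr _.
have -> : x' * y' - x * y = (x' - x) * y' + x * (y' - y).
  by rewrite mulrBl mulrBr addrA subrK.
apply: rpredD.
  by apply: two_sided_mulr; rewrite Quotient.idealrBE reprK.
by apply: two_sided_mull; rewrite Quotient.idealrBE reprK.
Qed.

Fact quotient_mulA : associative quotient_mul.
Proof.
move=> x y z; rewrite -[x]reprK -[y]reprK -[z]reprK.
rewrite (quotient_mulE (repr y)) (quotient_mulE (repr x) (_ * _)).
by rewrite (quotient_mulE (repr x)) quotient_mulE mulrA.
Qed.

Fact quotient_mul1 : left_id (\pi_Q 1) quotient_mul.
Proof. by move=> x; rewrite -[x]reprK quotient_mulE mul1r. Qed.

Fact quotient_mulr1 : right_id (\pi_Q 1) quotient_mul.
Proof. by move=> x; rewrite -[x]reprK quotient_mulE mulr1. Qed.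

Fact quotient_mulDl : left_distributive quotient_mul +%R.
Proof.
move=> x y z; rewrite -[x]reprK -[y]reprK -[z]reprK -raddfD !quotient_mulE.
by rewrite mulrDl raddfD.
Qed.

Fact quotient_mulDr : right_distributive quotient_mul +%R.
Proof.
move=> x y z; rewrite -[x]reprK -[y]reprK -[z]reprK -raddfD !quotient_mulE.
by rewrite mulrDr raddfD.
Qed.

HB.instance Definition _ := GRing.Zmodule_isPzRing.Build (quotient_ring I)
  quotient_mulA quotient_mul1 quotient_mulr1 quotient_mulDl quotient_mulDr.

Definition quotient_class (x : R) : quotient_ring I := \pi_Q x.

End QuotientRing.

Record quiver := Quiver {
  vertex : finType;
  arrow : finType;
  asource : arrow -> vertex;
  atarget : arrow -> vertex
}.

Section Quiver.
Variable G : quiver.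

Fixpoint composable (v : vertex G) (s : seq (arrow G)) : bool :=
  if s is a :: s' then (asource a == v) && composable (atarget a) s' else true.

(* A path is its starting vertex with its arrows in the order in which they
   are travelled along: the path a_n ... a_1, composed from right to left, is
   encoded by [:: a_1; ...; a_n]. *)
Record qpath := QPath {
  qpath_val :> vertex G * seq (arrow G);
  _ : composable qpath_val.1 qpath_val.2
}.
HB.instance Definition _ := [isSub for qpath_val].
HB.instance Definition _ := [Choice of qpath by <:].

Definition pstart (p : qpath) : vertex G := (val p).1.
Definition parrows (p : qpath) : seq (arrow G) := (val p).2.
Definition plength (p : qpath) : nat := size (parrows p).

(* e(1), ..., e(l+1) *)
Definition pvertices (p : qpath) : seq (vertex G) :=
  pstart p :: [seq atarget a | a <- parrows p].

Definition pend (p : qpath) : vertex G :=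
  last (pstart p) [seq atarget a | a <- parrows p].

Definition trivial_path (v : vertex G) : qpath :=
  @QPath (v, [::]) isT.

Fact arrow_path_subproof (a : arrow G) :
  composable (asource a, [:: a]).1 (asource a, [:: a]).2.
Proof. by rewrite /= eqxx. Qed.

Definition arrow_path (a : arrow G) : qpath :=
  QPath (arrow_path_subproof a).

(* The path p q, "first q, then p", when it exists; the composability test
   inside insub then always succeeds. *)
Definition pcomp (p q : qpath) : option qpath :=
  if pend q == pstart p then insub (pstart q, parrows q ++ parrows p) else None.

Lemma composable_cat v (s t : seq (arrow G)) :
  composable v (s ++ t) =
  composable v s && composable (last v [seq atarget a | a <- s]) t.
Proof. by elim: s v => //= a s IH v; rewrite IH andbA. Qed.

Variant pcomp_spec (p q : qpath) : option qpath -> Type :=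
  | PcompSome r of pend q = pstart p & pstart r = pstart q & pend r = pend p
      & parrows r = parrows q ++ parrows p : pcomp_spec p q (Some r)
  | PcompNone of pend q != pstart p : pcomp_spec p q None.

Lemma pcompP p q : pcomp_spec p q (pcomp p q).
Proof.
rewrite /pcomp; case: eqP => [e|/eqP]; last by constructor.
rewrite insubT /= => [|h].
  by rewrite composable_cat (valP q) -/(pend q) e (valP p).
constructor=> //; rewrite /pend /= map_cat last_cat -/(pend q).
by rewrite e.
Qed.

Lemma qpath_eq (p q : qpath) :
  pstart p = pstart q -> parrows p = parrows q -> p = q.
Proof.
rewrite /pstart /parrows => e1 e2; apply: val_inj.
by rewrite [LHS]surjective_pairing [RHS]surjective_pairing e1 e2.
Qed.

Lemma pcompA p q r :
  obind (pcomp p) (pcomp q r) = obind (pcomp^~ r) (pcomp p q).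
Proof.
case: (pcompP q r) => [qr e1 s1 t1 a1|n1] /=;
  case: (pcompP p q) => [pq e2 s2 t2 a2|n2] //=.
- case: pcompP => [x _ sx _ ax|]; last by rewrite t1 e2 eqxx.
  case: pcompP => [y _ sy _ ay|]; last by rewrite s2 e1 eqxx.
  congr Some; apply: qpath_eq; first by rewrite sx sy s1.
  by rewrite ax ay a1 a2 catA.
- by case: pcompP => // x; rewrite t1 => e; rewrite e eqxx in n2.
- by case: pcompP => // x; rewrite s2 => e; rewrite e eqxx in n1.
Qed.

Lemma pcomp_trivl v p :
  pcomp (trivial_path v) p = if pend p == v then Some p else None.
Proof.
case: pcompP => [r e s _ a|]; last by rewrite [pstart _]/= => /negPf ->.
rewrite e eqxx; congr Some; apply: qpath_eq => //.
by rewrite a [parrows (trivial_path v)]/= cats0.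
Qed.

Lemma pcomp_trivr v p :
  pcomp p (trivial_path v) = if v == pstart p then Some p else None.
Proof.
case: pcompP => [r e s _ a|]; last by rewrite /pend /= => /negPf ->.
rewrite -e eqxx; congr Some; apply: qpath_eq => //.
by rewrite s -e.
Qed.

Definition right_subpath (u p : qpath) : Prop :=
  exists r, pcomp r u = Some p.

Definition oriented_cycle (p : qpath) : Prop :=
  (0 < plength p)%N /\ pstart p = pend p.

Definition starts_with_oriented_cycle (p : qpath) : Prop :=
  exists2 u, right_subpath u p & oriented_cycle u.

(* The family v_i(a, u), i in I(a, u), as a set of paths; a right subpath of p
   is determined by its length, so the family has no repetitions. *)
Definition detour_targets (p : qpath) (a : arrow G) (u v : qpath) : Prop :=
  [/\ right_subpath v p, (plength u < plength v)%N & pend v = atarget a].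

Definition detour (p : qpath) (a : arrow G) (u : qpath) : Prop :=
  [/\ right_subpath u p,
      exists2 w, pcomp (arrow_path a) u = Some w & ~ right_subpath w p
    & exists v, [/\ right_subpath v p, (plength u + 1 <= plength v)%N
                  & pend v = atarget a]].

Definition route (p q : qpath) : Prop :=
  pstart q = pstart p /\ subseq (pvertices q) (pvertices p).

Definition nonroute (p q : qpath) : Prop :=
  pstart q = pstart p /\ ~ route p q.

End Quiver.

(* Finite formal K-linear combinations of paths; the coefficient of p in x is
   x@_p, and path_elt p is the basis vector p. Scaling and basis vectors are
   locked since unification is very slow when it unfolds their definitions. *)
Definition path_algebra (K : fieldType) (G : quiver) : Type :=
  {malg K[qpath G]}.

HB.instance Definition _ (K : fieldType) (G : quiver) :=
  GRing.Zmodule.on (path_algebra K G).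

HB.lock Definition path_scale (K : fieldType) (G : quiver) (c : K)
  (x : path_algebra K G) : path_algebra K G := (c *: (x : {malg K[qpath G]})).

HB.lock Definition path_elt (K : fieldType) (G : quiver) (p : qpath G) :
  path_algebra K G := << p >>.

Arguments path_elt {K G} p.

Section PathAlgebra.
Variables (K : fieldType) (G : quiver).
Local Notation KG := (path_algebra K G).

Lemma mcoeff_path_scale c (x : KG) p : (path_scale c x)@_p = c * x@_p.
Proof. by rewrite path_scale.unlock mcoeffZ. Qed.

Fact path_scaleA a b (x : KG) :
  path_scale a (path_scale b x) = path_scale (a * b) x.
Proof. by apply/malgP => p; rewrite !mcoeff_path_scale mulrA. Qed.

Fact path_scale1 : left_id 1 (@path_scale K G).
Proof. by move=> x; apply/malgP => p; rewrite mcoeff_path_scale mul1r. Qed.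

Fact path_scaleDr : right_distributive (@path_scale K G) +%R.
Proof.
move=> a x y; apply/malgP => p.
by rewrite mcoeffD !mcoeff_path_scale mcoeffD mulrDr.
Qed.

Fact path_scaleDl (x : KG) : {morph (@path_scale K G)^~ x : a b / a + b}.
Proof.
move=> a b; apply/malgP => p.
by rewrite mcoeffD !mcoeff_path_scale mulrDl.
Qed.

HB.instance Definition _ := GRing.Zmodule_isLmodule.Build K KG
  path_scaleA path_scale1 path_scaleDr path_scaleDl.

Lemma mcoeff_scale c (x : KG) p : (c *: x)@_p = c * x@_p.
Proof. exact: mcoeff_path_scale. Qed.

Lemma msupp_scale c (x : KG) : (msupp (c *: x) `<=` msupp x)%fset.
Proof.
apply/fsubsetP => p; rewrite -!mcoeff_neq0 mcoeff_scale.
by apply: contra => /eqP ->; rewrite mulr0.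
Qed.

Lemma mcoeff_elt (p q : qpath G) : (path_elt p : KG)@_q = (p == q)%:R.
Proof. by rewrite path_elt.unlock mcoeffU. Qed.

Lemma msupp_elt (p : qpath G) : msupp (path_elt p : KG) = [fset p]%fset.
Proof.
apply/fsetP => q; rewrite in_fset1 -mcoeff_neq0 mcoeff_elt (eq_sym q).
by case: (p == q); rewrite ?oner_eq0 ?eqxx.
Qed.

Definition path_prod (p q : qpath G) : KG :=
  if pcomp p q is Some r then path_elt r else 0.

Definition path_one : KG := \sum_(v : vertex G) path_elt (trivial_path v).

Definition path_mul (x y : KG) : KG :=
  \sum_(p <- msupp x) \sum_(q <- msupp y) (x@_p * y@_q) *: path_prod p q.

Lemma path_mulEw (d1 d2 : {fset qpath G}) (x y : KG) :
  (msupp x `<=` d1)%fset -> (msupp y `<=` d2)%fset ->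
  path_mul x y =
    \sum_(p <- d1) \sum_(q <- d2) (x@_p * y@_q) *: path_prod p q.
Proof.
move=> le1 le2; rewrite /path_mul (big_fset_incl _ le1) /=.
  apply: eq_bigr => p _; apply: big_fset_incl => // q _ /mcoeff_outdom ->.
  by rewrite mulr0 scale0r.
move=> p _ /mcoeff_outdom xp.
by rewrite big1 // => q _; rewrite xp mul0r scale0r.
Qed.

Fact path_mulDl : left_distributive path_mul +%R.
Proof.
move=> x y z; set d := (msupp x `|` msupp y)%fset.
rewrite (@path_mulEw d (msupp z) (x + y)) ?msuppD_le ?fsubset_refl //.
rewrite (@path_mulEw d (msupp z) x) ?fsubsetUl ?fsubset_refl //.
rewrite (@path_mulEw d (msupp z) y) ?fsubsetUr ?fsubset_refl //.
rewrite -big_split; apply: eq_bigr => p _; rewrite -big_split.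
by apply: eq_bigr => q _; rewrite mcoeffD mulrDl scalerDl.
Qed.

Fact path_mulDr : right_distributive path_mul +%R.
Proof.
move=> z x y; set d := (msupp x `|` msupp y)%fset.
rewrite (@path_mulEw (msupp z) d z (x + y)) ?msuppD_le ?fsubset_refl //.
rewrite (@path_mulEw (msupp z) d z x) ?fsubsetUl ?fsubset_refl //.
rewrite (@path_mulEw (msupp z) d z y) ?fsubsetUr ?fsubset_refl //.
rewrite -big_split; apply: eq_bigr => p _; rewrite -big_split.
by apply: eq_bigr => q _; rewrite mcoeffD mulrDr scalerDl.
Qed.

Lemma path_mul0l y : path_mul 0 y = 0.
Proof. by rewrite /path_mul msupp0 big_seq_fset0. Qed.

Lemma path_mul0r x : path_mul x 0 = 0.
Proof.
by rewrite /path_mul big1 // => p _; rewrite msupp0 big_seq_fset0.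
Qed.

Lemma path_mul_suml I (r : seq I) (F : I -> KG) y :
  path_mul (\sum_(i <- r) F i) y = \sum_(i <- r) path_mul (F i) y.
Proof.
exact: (big_morph (path_mul^~ y) (fun a b => path_mulDl a b y) (path_mul0l y)).
Qed.

Lemma path_mul_sumr I (r : seq I) (F : I -> KG) x :
  path_mul x (\sum_(i <- r) F i) = \sum_(i <- r) path_mul x (F i).
Proof. exact: (big_morph (path_mul x) (path_mulDr x) (path_mul0r x)). Qed.

Lemma path_mulZl c x y : path_mul (c *: x) y = c *: path_mul x y.
Proof.
rewrite (path_mulEw (msupp_scale c x) (fsubset_refl _)) /path_mul scaler_sumr.
apply: eq_bigr => p _; rewrite scaler_sumr; apply: eq_bigr => q _.
by rewrite mcoeff_scale scalerA mulrA.
Qed.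

Lemma path_mulZr c x y : path_mul x (c *: y) = c *: path_mul x y.
Proof.
rewrite (path_mulEw (fsubset_refl _) (msupp_scale c y)) /path_mul scaler_sumr.
apply: eq_bigr => p _; rewrite scaler_sumr; apply: eq_bigr => q _.
by rewrite mcoeff_scale scalerA mulrCA.
Qed.

Lemma path_mulE p q : path_mul (path_elt p) (path_elt q) = path_prod p q.
Proof.
by rewrite /path_mul !msupp_elt !big_seq_fset1 !mcoeff_elt !eqxx mulr1 scale1r.
Qed.

Lemma path_algebraE (x : KG) : x = \sum_(p <- msupp x) x@_p *: path_elt p.
Proof.
apply/malgP => q; rewrite raddf_sum /=.
under eq_bigr => p _ do rewrite mcoeff_scale mcoeff_elt.
have [qx|qx] := boolP (q \in msupp x).
  rewrite (big_fsetD1 q) //= eqxx mulr1 big1_fset ?addr0 // => p.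
  by rewrite in_fsetD1 => /andP[/negPf ->]; rewrite mulr0.
rewrite mcoeff_outdom // big1_fset // => p px _.
by have [e|_] := eqVneq p q; rewrite ?mulr0 //; rewrite -e px in qx.
Qed.

Lemma path_algebra_ind (P : KG -> Prop) :
    P 0 -> (forall x y, P x -> P y -> P (x + y)) ->
    (forall c x, P x -> P (c *: x)) -> (forall e p, e = path_elt p -> P e) ->
  forall x, P x.
Proof.
move=> P0 PD PZ Pp x; rewrite [x]path_algebraE.
by apply: (big_ind P) => // p _; exact/PZ/Pp.
Qed.

Fact path_mulA : associative path_mul.
Proof.
have := (path_mulDl, path_mulDr, path_mul0l, path_mul0r).
have := (path_mulZl, path_mulZr, path_mulE).
move: path_mul => m [[mZl mZr] mE] [[[mDl mDr] m0l] m0r] x y z.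
elim/path_algebra_ind: x => [|x x' ex ex'|c x ex|x p xp].
- by rewrite !m0l.
- by rewrite !mDl ex ex'.
- by rewrite !mZl ex.
elim/path_algebra_ind: y => [|y y' ey ey'|c y ey|y q yq].
- by rewrite m0l m0r m0l.
- by rewrite mDl !mDr mDl ey ey'.
- by rewrite mZl !mZr mZl ey.
elim/path_algebra_ind: z => [|z z' ez ez'|c z ez|z r zr].
- by rewrite !m0r.
- by rewrite !mDr ez ez'.
- by rewrite !mZr ez.
have -> : m y z = path_prod q r by rewrite yq zr mE.
have -> : m x y = path_prod p q by rewrite xp yq mE.
rewrite /path_prod; have := pcompA p q r.
case: (pcomp q r) (pcomp p q) => [qr|] [pq|] /= e.
- by rewrite xp zr !mE /path_prod e.
- by rewrite m0l xp mE /path_prod e.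
- by rewrite m0r zr mE /path_prod -e.
- by rewrite m0l m0r.
Qed.

Fact path_mul1l : left_id path_one path_mul.
Proof.
move=> x; rewrite [x in LHS]path_algebraE [RHS]path_algebraE path_mul_sumr.
apply: eq_bigr => p _; rewrite path_mulZr; congr (_ *: _).
rewrite path_mul_suml (bigD1 (pend p)) //= path_mulE /path_prod.
rewrite pcomp_trivl eqxx big1 ?addr0 // => v nv.
by rewrite path_mulE /path_prod pcomp_trivl eq_sym (negPf nv).
Qed.

Fact path_mul1r : right_id path_one path_mul.
Proof.
move=> x; rewrite [x in LHS]path_algebraE [RHS]path_algebraE path_mul_suml.
apply: eq_bigr => p _; rewrite path_mulZl; congr (_ *: _).
rewrite path_mul_sumr (bigD1 (pstart p)) //= path_mulE /path_prod.
rewrite pcomp_trivr eqxx big1 ?addr0 // => v nv.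
by rewrite path_mulE /path_prod pcomp_trivr (negPf nv).
Qed.

HB.instance Definition _ := GRing.Zmodule_isPzRing.Build KG
  path_mulA path_mul1l path_mul1r path_mulDl path_mulDr.

Definition combination_of (P : qpath G -> Prop) (x : KG) : Prop :=
  forall p, p \in msupp x -> P p.

(* R^m <= I <= R^2 for some m >= 2, where R is the ideal generated by the
   arrows; R^m is the span of the paths of length at least m. *)
Definition admissible (I : two_sided_ideal KG) : Prop :=
  (forall x, x \in I -> combination_of (fun p => 2 <= plength p)%N x) /\
  exists2 m, (2 <= m)%N &
    forall x : KG, combination_of (fun p => m <= plength p)%N x -> x \in I.

End PathAlgebra.

Section Mast.
Variables (K : fieldType) (G : quiver).
Variable I : two_sided_ideal (path_algebra K G).
Local Notation Lambda := (quotient_ring I).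

Definition path_class (p : qpath G) : Lambda := quotient_class I (path_elt p).

Definition mast (U : lmodType Lambda) (p : qpath G) : Prop :=
  has_length U (plength p).+1 /\ exists x : U, path_class p *: x != 0.

Definition inessential (p : qpath G) (a : arrow G) (u : qpath G) : Prop :=
  exists s t : path_algebra K G,
    [/\ combination_of (fun q => ~ route p q) s,
        combination_of (detour_targets p a u) t
      & quotient_class I (path_elt (arrow_path a) * path_elt u) =
        quotient_class I (s + t)].

(* Lambda e / J p, for e = s(p); J p is a submodule of Lambda e as p = p e. *)
Definition mast_quotient (p : qpath G) : lmodType Lambda :=
  let Le : submodClosed Lambda^o :=
    ideal_mul (@whole_ring Lambda)
      (path_class (trivial_path (pstart p)) : Lambda^o) in
  let Jp : submodClosed Lambda^o :=
    ideal_mul (@jacobson_radical Lambda) (path_class p : Lambda^o) in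
  quotient_module (submodule_trace Le Jp).

End Mast.

(* Main.v *)
From HB Require Import structures.
From mathcomp Require Import all_boot all_algebra.
From mathcomp Require Import finmap boolp monalg.
Require Import Defs.

(** Let e = s(p), and choose x in U with ex = x and px <> 0. Write M for the
    left ideal of those a in Lambda e with ax = 0. Everything follows from the
    equality M = Jp.

    Layers. Let U = d_0 > d_1 > ... > d_{l+1} = 0 be a composition series, where
    l is the length of p, and let u_i be the right subpath of p of length i.
    As J pushes each layer into the next one and px <> 0, the element u_i x lies
    in d_i but not in d_{i+1}. A simple module is one-dimensional and lives at
    a single vertex, so d_i is spanned by u_i x modulo d_{i+1}, and that factor
    lives at the end vertex of u_i ([layer_mod_next], [layer_other_vertex]).
    Hence an element of d_i that lives at a vertex v is a combination of the
    u_j x with j >= i and u_j ending at v ([layer_span]), and a path which acts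
    nontrivially on x can only visit the vertices of p, in their order:
    non-routes kill x ([nonroute_annihilates]).

    From M = Jp to the three conclusions. A non-route q starts at e and kills
    x, so q is in M. For a detour (alpha, u), the element alpha u x is a
    combination of elements v x with v a longer right subpath of p ending where
    alpha ends; the difference between alpha u and the same combination of the
    v is in M = Jp, hence is a combination of paths strictly longer than p,
    which are not routes. Finally U = Lambda x is Lambda e / M.

    Irreducibility gives M inside Lambda p. The embedding of JU into U factors
    through the pushout X of Lambda and JU along the two maps b p |-> b p and
    b p |-> b p x ([irreducible_inclusion_pushout]). As p does not start with
    an oriented cycle, the vertex e does not occur among the composition factors
    of JU, that is, e JU = 0. A retraction of JU -> X would give w in JU with
    px = pw = p(ew) = 0, so X -> U has a section. Its value at x is the
    class of some (f, w), and e JU = 0 allows the choice f in e Lambda e, with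
    fx = x. Elements of M kill x, hence the class of (f, w), which says that
    Mf lies in Lambda p. Now f = e + m with m in M and m in J, hence nilpotent:
    from a + am in Lambda p for every a in M one descends along a m^k to obtain
    a in Lambda p ([unipotent_absorb]).

    From Lambda p to Jp. Modulo Jp, an element b p is a scalar multiple of p;
    since Jpx = 0 and px <> 0, that scalar vanishes if b p kills x
    ([annihilator_in_mast_radical]). *)

Set Implicit Arguments.
Unset Strict Implicit.
Unset Printing Implicit Defensive.

Import GRing.Theory.
Local Open Scope ring_scope.
Local Open Scope quotient_scope.

(** * Quotients, and the pushout attached to a submodule *)

Section QuotientMaps.
Variables (R : pzRingType) (M : lmodType R) (S : submodClosed M).

Definition quotient_proj (x : M) : quotient_module S :=
  \pi_(Quotient.quot (submodule_subgroup S)) x.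

Fact quotient_proj_linear : linear quotient_proj.
Proof.
move=> a x y; rewrite /quotient_proj raddfD; congr (_ + _).
exact: esym (quotient_scaleE S a x).
Qed.

HB.instance Definition _ :=
  GRing.isLinear.Build R M (quotient_module S) *:%R quotient_proj
    quotient_proj_linear.

Lemma quotient_proj_eq0 x : (quotient_proj x == 0) = (x \in S).
Proof.
rewrite -(raddf0 quotient_proj) /quotient_proj.
by rewrite -[LHS]Quotient.idealrBE subr0.
Qed.

Lemma quotient_proj_repr (y : quotient_module S) :
  quotient_proj (repr (y : Quotient.quot (submodule_subgroup S))) = y.
Proof. exact: reprK. Qed.

Lemma quotient_proj_surj (y : quotient_module S) :
  exists x, y = quotient_proj x.
Proof.
exists (repr (y : Quotient.quot (submodule_subgroup S))).
by rewrite quotient_proj_repr.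
Qed.

Section Lift.
Variables (N : lmodType R) (f : {linear M -> N}).

(** The proof that f vanishes on S is an argument so that a linear structure
    can be attached to the lifted function. *)
Definition quotient_lift (f0 : forall x, x \in S -> f x = 0)
    (y : quotient_module S) : N :=
  f (repr (y : Quotient.quot (submodule_subgroup S))).

Hypothesis f0 : forall x, x \in S -> f x = 0.

Lemma quotient_liftE x : quotient_lift f0 (quotient_proj x) = f x.
Proof.
apply/eqP; rewrite -subr_eq0 -raddfB; apply/eqP/f0.
by rewrite -quotient_proj_eq0 raddfB subr_eq0 /=; apply/eqP/quotient_proj_repr.
Qed.

Fact quotient_lift_linear : linear (quotient_lift f0).
Proof.
move=> a y z.
have [y' ->] := quotient_proj_surj y; have [z' ->] := quotient_proj_surj z.
by rewrite -linearP !quotient_liftE linearP.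
Qed.

HB.instance Definition _ :=
  GRing.isLinear.Build R (quotient_module S) N *:%R (quotient_lift f0)
    quotient_lift_linear.
End Lift.
End QuotientMaps.

Lemma quotient_isomorphism (R : pzRingType) (M N : lmodType R)
    (S : submodClosed M) (f : {linear M -> N}) :
    (forall x, (x \in S) = (f x == 0)) -> (forall y, exists x, f x = y) ->
  isomorphic_modules N (quotient_module S).
Proof.
move=> ker_f f_surj; have f0 x : x \in S -> f x = 0 by rewrite ker_f => /eqP.
pose g : {linear quotient_module S -> N} := quotient_lift f0.
have g_surj y : exists q, g q = y.
  have [x <-] := f_surj y.
  by exists (quotient_proj S x); apply: quotient_liftE.
have g_inj : injective g.
  apply: raddf_inj => q; have [x ->] := quotient_proj_surj q.
  move=> gx0; have /eqP := etrans (esym (quotient_liftE f0 x)) gx0.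
  by rewrite -ker_f -quotient_proj_eq0 => /eqP.
pose h y := projT1 (cid (g_surj y)).
have hK : cancel h g by move=> y; exact: projT2 (cid (g_surj y)).
have gK : cancel g h by move=> q; apply: g_inj; rewrite hK.
pose hL := GRing.isLinear.Build _ _ _ _ h (can2_linear gK hK).
exists (HB.pack h hL : {linear N -> quotient_module S}).
by exists g.
Qed.

Section FactorThroughPushout.
Variables (R : pzRingType) (U : lmodType R) (W : submodClosed U).
Variables (x : U) (r : R).
Local Notation V := (submodule_type W).

(** The quotient of R (+) W by these pairs (b r, - b r x) is the pushout of R
    and W along the inclusion of R r in R and the map b r |-> b r x from R r to
    W, when r x is in W. *)
Definition pushout_relations : {pred (R^o * V)%type} :=
  [pred z | `[< exists b, z.1 = b * r /\ val z.2 = - (b * r *: x) >]].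

Fact pushout_relations_closed : subsemimod_closed pushout_relations.
Proof.
split; first split=> [|[a v] [b w]].
- by rewrite inE; apply/asboolP; exists 0; rewrite !mul0r scale0r oppr0.
- rewrite !inE => /asboolP[/= c [-> ev]] /asboolP[/= d [-> ew]].
  apply/asboolP; exists (c + d) => /=; rewrite -mulrDl; split=> //.
  by rewrite ev ew -opprD -scalerDl -mulrDl.
- move=> a [b w]; rewrite !inE => /asboolP[/= c [-> ew]].
  apply/asboolP; exists (a * c) => /=; rewrite -mulrA; split=> //.
  by rewrite ew scalerN scalerA.
Qed.

HB.instance Definition _ := GRing.isSubmodClosed.Build R (R^o * V)%type
  pushout_relations pushout_relations_closed.

Definition pushout_sum (z : (R^o * V)%type) : U := (z.1 : R) *: x + val z.2.

Fact pushout_sum_linear : linear pushout_sum.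
Proof.
move=> a [b v] [c w]; rewrite /pushout_sum /=.
by rewrite scalerDl scalerDr scalerA addrACA.
Qed.

HB.instance Definition _ :=
  GRing.isLinear.Build R (R^o * V)%type U *:%R pushout_sum pushout_sum_linear.

Lemma pushout_sum_eq0 z : z \in pushout_relations -> pushout_sum z = 0.
Proof. by rewrite inE /pushout_sum => /asboolP[b [-> ->]]; rewrite subrr. Qed.

Definition pushout_incr (w : V) : quotient_module pushout_relations :=
  quotient_proj pushout_relations (0, w).

Fact pushout_incr_linear : linear pushout_incr.
Proof.
move=> a v w; rewrite /pushout_incr -linearP; congr quotient_proj.
by congr (_, _); rewrite /= scaler0 addr0.
Qed.

HB.instance Definition _ :=
  GRing.isLinear.Build R V (quotient_module pushout_relations) *:%R pushout_incr
    pushout_incr_linear.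

(** The inclusion of W factors through the pushout, by w |-> (0, w) followed by
    (a, w) |-> a x + w. In the first case the former map has a retraction, and w
    is the image of the class of (1, 0). In the second one the latter has
    a section, and (f, w) represents the image of x; its annihilator contains
    that of x, which is read off on the first component of the relations. *)
Lemma irreducible_inclusion_pushout :
    irreducible_map (submodule_incl W) -> finitely_generated V ->
    r *: x \in W ->
  (exists2 w, w \in W & r *: w = r *: x) \/
  (exists f w, [/\ w \in W, f *: x + w = x
     & forall a, a *: x = 0 -> exists b, a * f = b * r]).
Proof.
move=> [_ _ irr] [n [g gP]] rxW.
pose X : lmodType R := quotient_module pushout_relations.
pose pr : {linear (R^o * V)%type -> X} := quotient_proj pushout_relations.
have Xfg : finitely_generated X.
  exists n.+1.
  exists (fun i => pr (if unlift ord0 i is Some j then (0, g j) else (1, 0))).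
  move=> y; have [[a v] ->] := quotient_proj_surj y.
  have [c ev] := gP v.
  exists (fun i => if unlift ord0 i is Some j then c j else a).
  rewrite big_ord_recl unlift_none.
  under eq_bigr => i _ do rewrite liftK -linearZ.
  rewrite -linear_sum -linearZ -linearD /=; congr quotient_proj.
  rewrite [in LHS]ev.
  have -> : \sum_i c i *: ((0, g i) : (R^o * V)%type) = (0, \sum_i c i *: g i).
    apply: (big_ind2 (fun z w => z = (0, w))) => // [_ z _ w -> ->|i _].
      by congr (_, _); rewrite /= addr0.
    by congr (_, _); rewrite /= scaler0.
  congr (_, _) => /=; last by rewrite scaler0 add0r.
  by rewrite addr0; exact: esym (mulr1 a).
have incl_factors v :
    submodule_incl W v = quotient_lift pushout_sum_eq0 (pushout_incr v).
  by rewrite quotient_liftE /= /pushout_sum scale0r add0r.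
have [[h hK]|[h hK]] := irr X (quotient_lift pushout_sum_eq0)
  pushout_incr Xfg incl_factors.
- left; exists (val (h (pr (1, 0)))); first exact: valP.
  have ehr : r *: h (pr (1, 0)) = h (pr (r, 0)).
    rewrite -!linearZ; congr (h (pr (_, _))); rewrite ?scaler0 //.
    exact: mulr1.
  pose rx : V := Sub (r *: x) rxW.
  transitivity (val (r *: h (pr (1, 0)))); first by rewrite linearZ.
  rewrite ehr -[RHS]/(val rx) -(hK rx); congr val; congr (h _).
  apply/eqP; rewrite -subr_eq0 -linearB quotient_proj_eq0 inE.
  apply/asboolP; exists 1; rewrite mul1r /= subr0.
  split=> //; rewrite -[LHS]/(submodule_incl W (0 - rx)) sub0r.
  exact: (raddfN (submodule_incl W)).
- right; have [[f w] efw] := quotient_proj_surj (h x).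
  exists f, (val w); split; first exact: valP.
    transitivity (quotient_lift pushout_sum_eq0 (h x)); last exact: hK.
    by rewrite efw (quotient_liftE pushout_sum_eq0 (f, w)).
  move=> a ax0; have : pr (a *: ((f, w) : (R^o * V)%type)) == 0.
    by rewrite linearZ /= -[X in _ *: X]efw -linearZ ax0 linear0.
  rewrite quotient_proj_eq0 inE => /asboolP[b [eb _]]; exists b.
  exact: eb.
Qed.
End FactorThroughPushout.

(** * The Jacobson radical as an intersection of maximal left ideals *)

Section JacobsonRadical.
Variable R : pzRingType.
Implicit Types (M : lmodType R) (J m : submodClosed R^o).

Definition transporter M (S : submodClosed M) (y : M) : {pred R^o} :=
  [pred a | (a : R) *: y \in S].

Fact transporter_closed M (S : submodClosed M) y :
  subsemimod_closed (transporter S y).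
Proof.
split; first split=> [|a b].
- by rewrite inE scale0r rpred0.
- by rewrite !inE scalerDl; apply: rpredD.
- by move=> a b; rewrite !inE -[a *: b]/((a : R) * b) -scalerA; apply: rpredZ.
Qed.

HB.instance Definition _ M (S : submodClosed M) y :=
  GRing.isSubmodClosed.Build R R^o (transporter S y) (transporter_closed S y).

Lemma simple_factor_generated M (S T : submodClosed M) y z :
    simple_module (quotient_module (submodule_trace T S)) ->
    y \in T -> y \notin S -> z \in T ->
  exists a, z - a *: y \in S.
Proof.
move=> [_ simpleQ] Ty nSy Tz.
pose pr := quotient_proj (submodule_trace T S).
pose ty : submodule_type T := Sub y Ty; pose tz : submodule_type T := Sub z Tz.
have [y0|full] := simpleQ (ideal_mul (@whole_ring R) (pr ty)).
  case/negP: nSy; rewrite -[y]/(val ty) -[_ \in S]/(ty \in submodule_trace T S).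
  rewrite -quotient_proj_eq0; apply/eqP/y0; rewrite inE; apply/asboolP.
  by exists 1; rewrite ?scale1r.
have := full (pr tz); rewrite inE => /asboolP[a _ /eqP].
rewrite -subr_eq0 -linearZ -linearB quotient_proj_eq0 inE => Sza.
exists a; move: Sza; rewrite -[val _]/(submodule_incl T (tz - a *: ty)).
by rewrite linearB linearZ.
Qed.

(** If y is in T but not in S, those a with a y in S form a maximal left ideal,
    because T/S is simple. *)
Lemma jacobson_simple_factor M (S T : submodClosed M) j y :
    simple_module (quotient_module (submodule_trace T S)) ->
    j \in @jacobson_radical R -> y \in T -> j *: y \in S.
Proof.
move=> simpleTS; rewrite inE => /asboolP Jj Ty.
have [Sy|nSy] := boolP (y \in S); first exact: rpredZ.
apply: (Jj (transporter S y)); split=> [|n le_n n1 b nb].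
  by rewrite inE scale1r.
rewrite inE; apply: contraR n1 => nSby.
have [a] := simple_factor_generated simpleTS (rpredZ b Ty) nSby Ty.
rewrite -{1}[y]scale1r scalerA -scalerBl => /le_n n1ab.
rewrite -[1](subrK (a * b)); apply: rpredD => //.
exact: (rpredZ a nb).
Qed.

Definition ideal_adjoin m (a : R) : {pred R^o} :=
  [pred c | `[< exists b, c - b * a \in m >]].

Fact ideal_adjoin_closed m a : subsemimod_closed (ideal_adjoin m a).
Proof.
split; first split=> [|c d].
- rewrite inE; apply/asboolP; exists 0; rewrite mul0r subr0.
  exact: (rpred0 m).
- rewrite !inE => /asboolP[b mc] /asboolP[b' md]; apply/asboolP.
  by exists (b + b'); rewrite mulrDl opprD addrACA; exact: (rpredD mc md).
- move=> e c; rewrite !inE => /asboolP[b mc]; apply/asboolP; exists (e * b).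
  by rewrite -mulrA -mulrBr; exact: (rpredZ e mc).
Qed.

HB.instance Definition _ m a := GRing.isSubmodClosed.Build R R^o
  (ideal_adjoin m a) (ideal_adjoin_closed m a).

(** A maximal left ideal m that misses a satisfies 1 - t in m with t = b a in N
    nilpotent, and the telescoping sum 1 - t^n is then in m too. *)
Lemma nil_left_ideal_jacobson (N : submodClosed R^o) :
  (forall a : R, a \in N -> exists n, a ^+ n = 0) ->
  {subset N <= @jacobson_radical R}.
Proof.
move=> nilN a Na; apply/asboolP => m [m1 maxm].
have [//|ma] := boolP (a \in m); exfalso.
have [n1|n1] := boolP ((1 : R^o) \in ideal_adjoin m a); last first.
  case/negP: ma; apply: (maxm _ _ n1) => [c mc|]; rewrite inE; apply/asboolP.
    by exists 0; rewrite mul0r subr0.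
  by exists 1; rewrite mul1r subrr; exact: (rpred0 m).
move: n1; rewrite inE => /asboolP[b m1t]; set t := b * a in m1t.
have [n tn0] := nilN t (rpredZ b Na).
case/negP: m1; rewrite -[1]subr0 -tn0; elim: n {tn0} => [|n IH].
  by rewrite expr0 subrr; exact: (rpred0 m).
have -> : 1 - t ^+ n.+1 = (1 - t ^+ n) + t ^+ n * (1 - t).
  by rewrite mulrBr mulr1 exprSr addrA subrK.
exact: (rpredD IH (rpredZ (t ^+ n) m1t)).
Qed.
End JacobsonRadical.

Lemma submod_opp (R : pzRingType) (M : lmodType R) (S : submodClosed M) y :
  (- y \in S) = (y \in S).
Proof.
have opp z : z \in S -> - z \in S by rewrite -scaleN1r; apply: rpredZ.
by apply/idP/idP => [/opp|/opp //]; rewrite opprK.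
Qed.

(** If e is idempotent, this is the kernel of the map R e -> M, a |-> a x. *)
Definition annihilator_of (R : pzRingType) (M : lmodType R) (e : R) (x : M) :
    {pred R^o} :=
  [pred a : R^o | ((a : R) * e == a) && ((a : R) *: x == 0)].

Fact annihilator_of_closed (R : pzRingType) (M : lmodType R) (e : R) (x : M) :
  subsemimod_closed (annihilator_of e x).
Proof.
split; first split=> [|a b].
- by rewrite inE mul0r scale0r !eqxx.
- rewrite !inE => /andP[/eqP ae /eqP ax] /andP[/eqP be /eqP bx].
  by rewrite mulrDl scalerDl ae ax be bx addr0 !eqxx.
- move=> a b; rewrite !inE => /andP[/eqP be /eqP bx].
  by rewrite -[a *: b]/((a : R) * b) -mulrA be -scalerA bx scaler0 !eqxx.
Qed.

HB.instance Definition _ (R : pzRingType) (M : lmodType R) (e : R) (x : M) :=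
  GRing.isSubmodClosed.Build R R^o (annihilator_of e x)
    (annihilator_of_closed e x).

(** As m is nilpotent, 1 + m is invertible; as m lies in the left ideal M, right
    multiplication by m preserves M. Hence M = M (1 + m). The proof descends
    along the powers of m instead of inverting 1 + m. *)
Lemma unipotent_absorb (R : pzRingType) (M L : submodClosed R^o) (m a : R) :
    m \in M -> (exists n, m ^+ n = 0) ->
    (forall b : R, b \in M -> b + b * m \in L) ->
  a \in M -> a \in L.
Proof.
move=> Mm [n mn0] ML Ma.
suff: forall i, (i <= n)%N -> a * m ^+ (n - i) \in L.
  by move/(_ n (leqnn n)); rewrite subnn expr0 mulr1.
elim=> [_|i IH lt_in].
  by rewrite subn0 mn0 mulr0; exact: (rpred0 L).
have Mami : a * m ^+ (n - i.+1) \in M.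
  case: (n - i.+1)%N => [|k]; first by rewrite expr0 mulr1.
  by rewrite exprSr mulrA; apply: (rpredZ _ Mm).
have := IH (ltnW lt_in); rewrite -(submod_opp L) => LN.
have := rpredD (ML _ Mami) LN.
by rewrite -mulrA -exprSr subnSK // [X in X \in _]addrK.
Qed.

Lemma simple_of_length1 (R : pzRingType) (U : lmodType R) :
  has_length U 1 -> simple_module U.
Proof.
move=> [c [bot top /(_ 0%N isT)[_ simpleU]]].
have gen (y z : U) : y != 0 -> exists a, z = a *: y.
  move=> y0; have [|a] := simple_factor_generated simpleU (top y) _ (top z).
    by rewrite bot.
  by rewrite bot subr_eq0 => /eqP ->; exists a.
split.
  have [[q q0] _] := simpleU; have [q' eq] := quotient_proj_surj q.
  exists (val q'); apply: contra q0 => /eqP q'0.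
  by rewrite eq quotient_proj_eq0 inE q'0 rpred0.
move=> S; have [S0|] := pselect (forall y, y \in S -> y = 0); first by left.
move=> /existsNP[y /not_implyP[Sy /eqP y0]]; right=> z.
by have [a ->] := gen y z y0; apply: rpredZ.
Qed.

(** * Path algebras and their admissible quotients *)

Section Paths.
Variable G : quiver.
Implicit Types (p q r : qpath G) (v : vertex G).

Lemma plength0 q : plength q = 0%N -> q = trivial_path (pstart q).
Proof. by move/size0nil => e; apply: qpath_eq. Qed.

Lemma pcomp_length p q r : pcomp p q = Some r ->
  plength r = (plength p + plength q)%N.
Proof.
case: pcompP => // r' _ _ _ e [<-].
by rewrite /plength e size_cat addnC.
Qed.

Lemma right_subpath_start u p : right_subpath u p -> pstart u = pstart p.
Proof. by move=> [r]; case: pcompP => // w _ sw _ _ [<-]. Qed.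

End Paths.

Section PathAlgebra.
Variables (K : fieldType) (G : quiver).
Local Notation KG := (path_algebra K G).
Implicit Types (x y z : KG) (P Q S : qpath G -> Prop) (p q r : qpath G).

Lemma path_eltM p q : path_elt p * path_elt q = path_prod K p q :> KG.
Proof. exact: path_mulE. Qed.

Lemma path_scaleAl c x y : (c *: x) * y = c *: (x * y).
Proof. exact: path_mulZl. Qed.

Lemma path_scaleAr c x y : x * (c *: y) = c *: (x * y).
Proof. exact: path_mulZr. Qed.

Lemma combination0 P : combination_of P (0 : KG).
Proof. by move=> p; rewrite msupp0. Qed.

Lemma combinationD P x y :
  combination_of P x -> combination_of P y -> combination_of P (x + y).
Proof.
move=> Px Py p; rewrite -mcoeff_neq0 mcoeffD.
have [/Px//|nx] := boolP (p \in msupp x).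
have [/Py//|ny] := boolP (p \in msupp y).
by rewrite !mcoeff_outdom ?addr0 ?eqxx.
Qed.

Lemma combinationZ P c x : combination_of P x -> combination_of P (c *: x).
Proof. by move=> Px p /(fsubsetP (msupp_scale c x))/Px. Qed.

Lemma combination_sum P (T : eqType) (s : seq T) (F : T -> KG) :
    (forall i, i \in s -> combination_of P (F i)) ->
  combination_of P (\sum_(i <- s) F i).
Proof.
move=> PF; rewrite big_seq; apply: (big_ind (combination_of P)) => //.
- exact: combination0.
- exact: combinationD.
Qed.

Lemma combination_elt P p : P p -> combination_of P (path_elt p : KG).
Proof. by move=> Pp q; rewrite msupp_elt in_fset1 => /eqP ->. Qed.

Lemma combination_sub P Q x : (forall p, P p -> Q p) ->
  combination_of P x -> combination_of Q x.
Proof. by move=> PQ Px p /Px/PQ. Qed.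

Lemma combinationM P Q S x y :
    (forall p q r, P p -> Q q -> pcomp p q = Some r -> S r) ->
  combination_of P x -> combination_of Q y -> combination_of S (x * y).
Proof.
move=> PQS Px Qy; apply: combination_sum => p /Px Pp.
apply: combination_sum => q /Qy Qq; apply: combinationZ; rewrite /path_prod.
case e: (pcomp p q) => [r|]; last exact: combination0.
exact: combination_elt (PQS _ _ _ Pp Qq e).
Qed.

Lemma combination_lengthM m n x y :
    combination_of (fun p => m <= plength p)%N x ->
    combination_of (fun p => n <= plength p)%N y ->
  combination_of (fun p => m + n <= plength p)%N (x * y).
Proof.
by apply: combinationM => p q r mp nq /pcomp_length ->; apply: leq_add.
Qed.

Lemma combination_lengthX n x : combination_of (fun p => 0 < plength p)%N x ->
  combination_of (fun p => n <= plength p)%N (x ^+ n).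
Proof.
move=> x1; elim: n => [|n IH]; first by move=> p.
by rewrite exprS -add1n; apply: combination_lengthM.
Qed.

(** A product of paths is trivial only if both factors are; so taking the
    coefficient of a trivial path is multiplicative. *)
Lemma mcoeff_trivialM x y v :
  (x * y)@_(trivial_path v) = x@_(trivial_path v) * y@_(trivial_path v).
Proof.
elim/path_algebra_ind: x => [|x x' ex ex'|c x ex|_ p ->].
- by rewrite mul0r !mcoeff0 mul0r.
- by rewrite mulrDl !mcoeffD ex ex' mulrDl.
- by rewrite path_scaleAl !mcoeff_scale ex mulrA.
elim/path_algebra_ind: y => [|y y' ey ey'|c y ey|_ q ->].
- by rewrite mulr0 !mcoeff0 mulr0.
- by rewrite mulrDr !mcoeffD ey ey' mulrDr.
- by rewrite path_scaleAr !mcoeff_scale ey mulrCA.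
rewrite path_eltM /path_prod !mcoeff_elt -natrM mulnb.
case e: (pcomp p q) => [r|]; last first.
  rewrite mcoeff0; case: eqP e => [->|//]; case: eqP => [->|//].
  by rewrite pcomp_trivl eqxx.
rewrite mcoeff_elt; congr (nat_of_bool _)%:R.
apply/eqP/andP => [er|[/eqP ep /eqP eq]].
  move: (pcomp_length e); rewrite er => /esym/eqP; rewrite addn_eq0.
  case/andP=> /eqP/plength0 ep /eqP/plength0 eq; move: e.
  rewrite ep eq pcomp_trivl er.
  by case: eqP => // <- [->].
by move: e; rewrite ep eq pcomp_trivl eqxx => -[<-].
Qed.

Lemma mcoeff1_trivial v : (1 : KG)@_(trivial_path v) = 1.
Proof.
rewrite (raddf_sum (mcoeff _)) /= (bigD1 v) //= mcoeff_elt eqxx.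
rewrite big1 ?addr0 // => w nw; rewrite mcoeff_elt; case: eqP => // e.
have ew : w = v := congr1 (@pstart G) e.
by rewrite ew eqxx in nw.
Qed.

Lemma combination_positiveP x :
  (forall v, x@_(trivial_path v) = 0) <->
  combination_of (fun p => 0 < plength p)%N x.
Proof.
split=> [x0 p|Px v].
  rewrite -mcoeff_neq0 lt0n; apply: contraNN => /eqP/plength0 ->.
  exact/eqP/x0.
apply/eqP; rewrite -[_ == 0]negbK mcoeff_neq0.
by apply/negP => /Px.
Qed.

End PathAlgebra.

Section BoundQuiverAlgebra.
Variables (K : fieldType) (G : quiver).
Variable I : two_sided_ideal (path_algebra K G).
Local Notation KG := (path_algebra K G).
Local Notation Lambda := (quotient_ring I).
Local Notation cls := (quotient_class I).
Local Notation J := (@jacobson_radical Lambda).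
Local Notation vclass v := (path_class I (trivial_path v)).
Implicit Types (x y z : KG) (a b : Lambda) (p q r : qpath G).

Lemma class_surj a : exists x, a = cls x.
Proof.
exists (repr (a : Quotient.quot I)).
by rewrite /quotient_class reprK.
Qed.

Lemma classD x y : cls (x + y) = cls x + cls y.
Proof. exact: raddfD. Qed.

Lemma classB x y : cls (x - y) = cls x - cls y.
Proof. exact: raddfB. Qed.

Lemma class0 : cls 0 = 0.
Proof. exact: raddf0. Qed.

Lemma classM x y : cls (x * y) = cls x * cls y.
Proof. exact/esym/quotient_mulE. Qed.

Lemma class1 : cls 1 = 1.
Proof. by []. Qed.

Lemma class_eq0 x : (cls x == 0) = (x \in I).
Proof. by rewrite -class0 -[LHS]Quotient.idealrBE subr0. Qed.



Lemma classX x n : cls (x ^+ n) = cls x ^+ n.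
Proof. by elim: n => [|n IH]; rewrite ?expr0 // !exprS classM IH. Qed.

Lemma path_classM p q r :
  pcomp p q = Some r -> path_class I p * path_class I q = path_class I r.
Proof. by move=> e; rewrite -classM path_eltM /path_prod e. Qed.

Lemma path_classM0 p q :
  pend q != pstart p -> path_class I p * path_class I q = 0.
Proof.
move=> ne; rewrite -classM path_eltM /path_prod -class0.
by case: pcompP => // r e; rewrite e eqxx in ne.
Qed.

Lemma vclassMpath v q :
  vclass v * path_class I q = if pend q == v then path_class I q else 0.
Proof.
case: ifP => [e|/negbT ne]; last exact: path_classM0.
by apply: path_classM; rewrite pcomp_trivl e.
Qed.

Lemma pathMvclass q v :
  path_class I q * vclass v = if v == pstart q then path_class I q else 0.
Proof.
case: ifP => [e|/negbT ne]; last exact: path_classM0.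
by apply: path_classM; rewrite pcomp_trivr e.
Qed.



(** The radical of Lambda is identified by two inclusions: [arrow_ideal] is nil
    (I contains all long paths), and each [vertex_ideal] is maximal, while their
    intersection is [arrow_ideal] (I contains no element with a trivial path in
    its support). *)
Definition arrow_ideal : {pred Lambda^o} :=
  [pred a | `[< exists2 x,
     combination_of (fun p => 0 < plength p)%N x & a = cls x >]].

Fact arrow_ideal_closed : subsemimod_closed arrow_ideal.
Proof.
split; first split=> [|a b].
- rewrite inE; apply/asboolP; exists 0; rewrite ?class0 //.
  exact: combination0.
- rewrite !inE => /asboolP[x x1 ->] /asboolP[y y1 ->]; apply/asboolP.
  by exists (x + y); rewrite ?classD //; exact: combinationD.
- move=> a b; rewrite !inE => /asboolP[y y1 ->]; apply/asboolP.
  have [x ->] := class_surj a.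
  exists (x * y); last by rewrite classM.
  by apply: (@combination_lengthM _ _ 0).
Qed.

HB.instance Definition _ := GRing.isSubmodClosed.Build Lambda Lambda^o
  arrow_ideal arrow_ideal_closed.

Definition vertex_ideal (v : vertex G) : {pred Lambda^o} :=
  [pred a | `[< exists2 x, x@_(trivial_path v) = 0 & a = cls x >]].

Fact vertex_ideal_closed v : subsemimod_closed (vertex_ideal v).
Proof.
split; first split=> [|a b].
- by rewrite inE; apply/asboolP; exists 0; rewrite ?class0 // mcoeff0.
- rewrite !inE => /asboolP[x x0 ->] /asboolP[y y0 ->]; apply/asboolP.
  by exists (x + y); rewrite ?classD // mcoeffD x0 y0 addr0.
- move=> a b; rewrite !inE => /asboolP[y y0 ->]; apply/asboolP.
  have [x ->] := class_surj a.
  by exists (x * y); rewrite ?classM // mcoeff_trivialM y0 mulr0.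
Qed.

HB.instance Definition _ v := GRing.isSubmodClosed.Build Lambda Lambda^o
  (vertex_ideal v) (vertex_ideal_closed v).

Hypothesis I_admissible : admissible I.

Lemma admissible_trivial x v : x \in I -> x@_(trivial_path v) = 0.
Proof.
move=> Ix; apply/combination_positiveP: v.
by apply: combination_sub (I_admissible.1 _ Ix) => p; apply: ltnW.
Qed.

Lemma vertex_idealE v x :
  (cls x \in vertex_ideal v) = (x@_(trivial_path v) == 0).
Proof.
rewrite inE; apply/asboolP/eqP => [[y y0 /eqP]|x0]; last by exists x.
rewrite -subr_eq0 -classB class_eq0 => /(admissible_trivial v).
by rewrite mcoeffB y0 subr0.
Qed.

Lemma vertex_ideal_maximal v : maximal_left_ideal (vertex_ideal v).
Proof.
have n1 : (1 : Lambda^o) \notin vertex_ideal v.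
  by rewrite -class1 vertex_idealE mcoeff1_trivial oner_eq0.
split=> // n le_n n1' a na; have [x ea] := class_surj a.
rewrite ea vertex_idealE; apply: contraR n1' => x0.
set c := x@_(_) in x0.
(* The vertex ideal has codimension 1: 1 differs from x / c by an element with
   zero coefficient at v. *)
pose d : KG := c^-1 *: (1 : KG).
have -> : 1 = cls (1 - d * x) + cls d * a.
  by rewrite ea -classM -classD subrK.
apply: rpredD; last exact: (rpredZ (cls d) na).
apply: le_n; rewrite vertex_idealE mcoeffB mcoeff_trivialM mcoeff_scale.
by rewrite mcoeff1_trivial mulr1 mulVf // subrr.
Qed.

Lemma arrow_ideal_nil a : a \in arrow_ideal -> exists n, a ^+ n = 0.
Proof.
rewrite inE => /asboolP[x x1 ->]; have [m _ Rm] := I_admissible.2; exists m.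
by rewrite -classX; apply/eqP; rewrite class_eq0; apply/Rm/combination_lengthX.
Qed.

Lemma jacobsonP a : reflect
  (exists2 x, combination_of (fun p => 0 < plength p)%N x & a = cls x)
  (a \in J).
Proof.
apply: (iffP idP) => [|Ra]; last first.
  apply: (nil_left_ideal_jacobson arrow_ideal_nil).
  by rewrite inE; apply/asboolP.
rewrite inE => /asboolP Ja; have [x ea] := class_surj a; exists x => //.
apply/combination_positiveP => v; apply/eqP; rewrite -vertex_idealE -ea.
exact/Ja/vertex_ideal_maximal.
Qed.

Lemma jacobson_nilpotent a : a \in J -> exists n, a ^+ n = 0.
Proof.
by move/jacobsonP=> Ra; apply: arrow_ideal_nil; rewrite inE; apply/asboolP.
Qed.

Lemma path_class_jacobson q : (0 < plength q)%N -> path_class I q \in J.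
Proof.
move=> q1; apply/jacobsonP; exists (path_elt q) => //.
exact: combination_elt.
Qed.

(** Lambda/J is a product of copies of K indexed by the vertices; this makes the
    simple modules one-dimensional, each supported at a single vertex. *)
Lemma vertex_scalar_mod_jacobson a v :
  exists c : K, a * vclass v - cls (c *: path_elt (trivial_path v)) \in J.
Proof.
have [x ->] := class_surj a; exists (x@_(trivial_path v)).
apply/jacobsonP; rewrite -classM -classB; eexists; last by [].
apply/combination_positiveP => w.
rewrite mcoeffB mcoeff_trivialM mcoeff_scale mcoeff_elt.
case: eqP => [e|_]; last by rewrite !mulr0 subrr.
have -> : w = v := esym (congr1 (@pstart G) e).
by rewrite subrr.
Qed.

Lemma vertex_scaleM c q v : pend q = v ->
  cls (c *: path_elt (trivial_path v)) * path_class I q = cls (c *: path_elt q).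
Proof.
move=> e; rewrite -classM path_scaleAl path_eltM /path_prod pcomp_trivl.
by rewrite e eqxx.
Qed.

Lemma vclassMscale v k q : vclass v * cls (k *: path_elt q) =
  if pend q == v then cls (k *: path_elt q) else 0.
Proof.
rewrite /path_class -classM path_scaleAr path_eltM /path_prod pcomp_trivl.
by case: ifP => // _; rewrite scaler0 class0.
Qed.

Lemma vertex_scale_inv (M : lmodType Lambda) (S : submodClosed M) (c : K) q
    (u : M) :
  c != 0 -> cls (c *: path_elt q) *: u \in S -> path_class I q *: u \in S.
Proof.
move=> c0 Su; have := rpredZ (cls (c^-1 *: (1 : KG))) Su.
by rewrite scalerA -classM path_scaleAl mul1r scalerA mulVf // scale1r.
Qed.
End BoundQuiverAlgebra.

(** * Composition series of a module with a mast *)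

Section Prefixes.
Variable G : quiver.
Implicit Types (p q r : qpath G).

Fact prefix_subproof p i :
  composable (pstart p, take i (parrows p)).1 (pstart p, take i (parrows p)).2.
Proof.
have := valP p; rewrite -/(pstart p) -/(parrows p).
by rewrite -{1}(cat_take_drop i (parrows p)) composable_cat => /andP[].
Qed.

Definition prefix_path p i : qpath G := QPath (prefix_subproof p i).

Lemma plength_prefix p i : (i <= plength p)%N -> plength (prefix_path p i) = i.
Proof. exact: size_takel. Qed.

Lemma prefix_path0 p : prefix_path p 0 = trivial_path (pstart p).
Proof. by apply: qpath_eq => //; rewrite /parrows /= take0. Qed.

Lemma prefix_path_extend p i j : (i <= j <= plength p)%N ->
  exists2 r, pcomp r (prefix_path p i) = Some (prefix_path p j)
           & plength r = (j - i)%N.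
Proof.
move=> /andP[ij jl]; set s := drop i (take j (parrows p)).
have es : take i (parrows p) ++ s = take j (parrows p).
  by rewrite -[take i _](@take_takel _ i j) // cat_take_drop.
have cs :
    composable (pend (prefix_path p i), s).1 (pend (prefix_path p i), s).2.
  have := prefix_subproof p j; rewrite /= -es composable_cat.
  by case/andP.
exists (QPath cs); last by rewrite /plength size_drop size_takel.
case: pcompP => [w _ sw _ aw|/eqP//]; congr Some; apply: qpath_eq => //.
by rewrite aw.
Qed.

Lemma prefix_path_full p : prefix_path p (plength p) = p.
Proof. by apply: qpath_eq => //; exact: take_size. Qed.

Lemma prefix_right_subpath p i : (i <= plength p)%N ->
  right_subpath (prefix_path p i) p.
Proof.
move=> il; have [|r er _] := @prefix_path_extend p i (plength p).
  by rewrite il leqnn.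
by exists r; rewrite er prefix_path_full.
Qed.

Lemma drop_pvertices p i : (i <= plength p)%N ->
  drop i (pvertices p) = pend (prefix_path p i) :: drop i.+1 (pvertices p).
Proof.
move=> il; rewrite (drop_nth (pstart p)); last by rewrite /= size_map.
congr cons; case: i il => [|i] il; first by rewrite prefix_path0.
rewrite /pend (last_nth (pstart p)) /= size_map size_takel //=.
by rewrite map_take nth_take.
Qed.

Lemma right_subpath_prefix p u : right_subpath u p ->
  (plength u <= plength p)%N /\ u = prefix_path p (plength u).
Proof.
move=> [r]; case: pcompP => // w _ sw _ aw [ew]; rewrite ew in sw aw.
split; first by rewrite /plength aw size_cat leq_addr.
apply: qpath_eq; rewrite // /prefix_path /parrows /= -/(parrows p) aw.
by rewrite take_size_cat.
Qed.

Lemma qpath_first_arrow q : (0 < plength q)%N ->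
  exists a q', [/\ asource a = pstart q, pcomp q' (arrow_path a) = Some q
    & pvertices q = pstart q :: pvertices q'].
Proof.
case: q => [[v [//|a s]] cq] _; have /= /andP[/eqP sa cs] := cq.
exists a, (@QPath _ (atarget a, s) cs); split=> //.
case: pcompP => [w _ sw _ aw|/eqP//]; congr Some; apply: qpath_eq => //.
by rewrite sw.
Qed.

End Prefixes.

(** In this section U has length l + 1, where l is the length of p. The
    composition series is indexed from the top, as [layer i], so that the right
    subpath of length i of p sends x into [layer i]. *)
Section MastedModule.
Variables (K : fieldType) (G : quiver).
Variable I : two_sided_ideal (path_algebra K G).
Hypothesis I_admissible : admissible I.
Local Notation Lambda := (quotient_ring I).
Local Notation cls := (quotient_class I).
Local Notation J := (@jacobson_radical Lambda).
Local Notation pc := (path_class I).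
Local Notation vclass v := (path_class I (trivial_path v)).
Variables (U : lmodType Lambda) (p : qpath G).
Local Notation l := (plength p).
Variable c : nat -> submodClosed U.
Hypothesis c_series : composition_series l.+1 c.
Variable x : U.
Hypothesis x_start : vclass (pstart p) *: x = x.
Hypothesis px_neq0 : pc p *: x != 0.
Local Notation pre i := (prefix_path p i).
Local Notation layer i := (c (l.+1 - i)).

Lemma layer_top y : y \in layer 0.
Proof. by case: c_series => _ top _; exact: top. Qed.

Lemma layer_bottom y : y \in layer l.+1 -> y = 0.
Proof. by case: c_series => bot _ _; rewrite subnn bot => /eqP. Qed.

Lemma layer_simple i : (i <= l)%N -> {subset layer i.+1 <= layer i} /\
  simple_module (quotient_module (submodule_trace (layer i) (layer i.+1))).
Proof.
move=> il; have [_ _ /(_ (l - i)%N)] := c_series.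
by rewrite ltnS leq_subr subSS subSn //; apply.
Qed.

Lemma layer_jacobson i j y : (i <= l)%N -> j \in J -> y \in layer i ->
  j *: y \in layer i.+1.
Proof.
by move=> il Jj; apply: jacobson_simple_factor (layer_simple il).2 Jj.
Qed.

Lemma path_layer q i y : (i + plength q <= l.+1)%N -> y \in layer i ->
  pc q *: y \in layer (i + plength q).
Proof.
move eqm: (plength q) => m; elim: m q i y eqm => [|m IH] q i y eqm il yi.
  by rewrite addn0; apply: rpredZ.
have [|a [q' [_ eq _]]] := @qpath_first_arrow _ q; first by rewrite eqm.
rewrite -(path_classM _ eq) -scalerA addnS -addSn; apply: IH.
- by have := pcomp_length eq; rewrite eqm addn1 => -[].
- by rewrite addSn -addnS.
apply: layer_jacobson => //.
  by rewrite -ltnS (leq_trans _ il) // addnS ltnS leq_addr.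
exact: path_class_jacobson.
Qed.

Lemma prefix_layer i : (i <= l)%N -> pc (pre i) *: x \in layer i.
Proof.
move=> il; have := @path_layer (pre i) 0 x; rewrite plength_prefix // add0n.
by apply; [exact: leqW | exact: layer_top].
Qed.

(** Otherwise the rest of p, of length l - i, would push px into layer l + 1. *)
Lemma prefix_notin_layer i : (i <= l)%N -> pc (pre i) *: x \notin layer i.+1.
Proof.
move=> il; apply: contra px_neq0 => ui.
have [|r er lr] := @prefix_path_extend _ p i l; first by rewrite il leqnn.
rewrite -(prefix_path_full p) -(path_classM _ er) -scalerA.
have := @path_layer r i.+1 _ _ ui; rewrite lr addSn subnKC // => /(_ (leqnn _)).
by move/layer_bottom => ->.
Qed.

(** The factor is generated by the class of u_i x, on which J acts as 0 and
    Lambda therefore acts through scalars. *)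
Lemma layer_mod_next i y : (i <= l)%N -> y \in layer i ->
  exists k : K, y - cls (k *: path_elt (pre i)) *: x \in layer i.+1.
Proof.
move=> il yi; have [a ya] := simple_factor_generated (layer_simple il).2
  (prefix_layer il) (prefix_notin_layer il) yi.
have [k Jk] := vertex_scalar_mod_jacobson I_admissible a (pend (pre i)).
exists k; rewrite -(vertex_scaleM I k (erefl (pend (pre i)))).
set s := cls _ in Jk *.
have -> : y - (s * pc (pre i)) *: x = y - a *: (pc (pre i) *: x)
    + (a * vclass (pend (pre i)) - s) *: (pc (pre i) *: x).
  rewrite scalerBl [(a * _) *: _]scalerA -mulrA vclassMpath eqxx -!scalerA.
  by rewrite addrA subrK.
by rewrite rpredD //; apply: layer_jacobson Jk (prefix_layer il).
Qed.

(** Multiply the relation of [layer_mod_next] by the idempotent of v, which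
    kills u_i. *)
Lemma layer_other_vertex i v y : (i <= l)%N -> y \in layer i ->
  vclass v *: y = y -> v != pend (pre i) -> y \in layer i.+1.
Proof.
move=> il yi yv nv; have [k yk] := layer_mod_next il yi.
have := rpredZ (vclass v) yk; rewrite scalerBr yv scalerA.
by rewrite vclassMscale [pend _ == v]eq_sym (negPf nv) scale0r subr0.
Qed.

Lemma layer_cyclic i y : (i <= l)%N -> y \in layer i ->
  exists a, y = a *: (pc (pre i) *: x).
Proof.
move=> il; have [d] := ubnP (l - i)%N; elim: d i il y => // d IH i il y ld yi.
have [k yk] := layer_mod_next il yi.
have [b eb] : exists b,
    y - cls (k *: path_elt (pre i)) *: x = b *: (pc (pre i) *: x).
  move: il; rewrite leq_eqVlt => /orP[/eqP il|il].
    by exists 0; rewrite scale0r; apply: layer_bottom; rewrite -{2}il.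
  have [|a ->] := IH i.+1 il _ _ yk.
    by rewrite -ltnS (leq_trans _ ld) // subnSK.
  have [|r er _] := @prefix_path_extend _ p i i.+1; first by rewrite leqnSn.
  by exists (a * pc r); rewrite -(path_classM _ er) !scalerA mulrA.
exists (b + cls (k *: path_elt (trivial_path (pend (pre i))))).
by rewrite scalerDl -eb scalerA vertex_scaleM // subrK.
Qed.

Lemma layer_span i v y : (i <= l.+1)%N -> y \in layer i -> vclass v *: y = y ->
  exists2 t, combination_of
      (fun q => [/\ right_subpath q p, (i <= plength q)%N & pend q = v]) t
    & y = cls t *: x.
Proof.
have [d] := ubnP (l.+1 - i)%N; elim: d i y => // d IH i y ld il yi yv.
move: il; rewrite leq_eqVlt => /orP[/eqP il|il].
  exists 0; first exact: combination0.
  by rewrite class0 scale0r; apply: layer_bottom; rewrite -{2}il.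
have ld' : (l.+1 - i.+1 < d)%N by rewrite -ltnS (leq_trans _ ld) // subnSK.
have [ev|nv] := eqVneq v (pend (pre i)); last first.
  have [t ct ->] := IH i.+1 y ld' il (layer_other_vertex il yi yv nv) yv.
  exists t => //; apply: (combination_sub _ ct) => q [? /ltnW ? ?].
  by split.
have [k yk] := layer_mod_next il yi.
have [|t ct et] := IH i.+1 _ ld' il yk.
  by rewrite scalerBr yv scalerA vclassMscale ev eqxx.
exists (t + k *: path_elt (pre i)).
  apply: combinationD.
    by apply: (combination_sub _ ct) => q [? /ltnW ? ?].
  apply: combinationZ; apply: combination_elt; split=> //.
    exact: prefix_right_subpath.
  by rewrite plength_prefix.
by rewrite classD scalerDl -et subrK.
Qed.

(** Going down the layers: either the current factor lives at another vertex
    than the start of q, and y is already one layer deeper, or that vertex is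
    matched and the first arrow of q sends y one layer deeper. *)
Lemma path_nonzero_subseq i q y : (i <= l.+1)%N -> y \in layer i ->
    vclass (pstart q) *: y = y -> pc q *: y != 0 ->
  subseq (pvertices q) (drop i (pvertices p)).
Proof.
have [d] := ubnP (l.+1 - i)%N; elim: d i q y => // d IH i q y ld il yi yq qy.
move: il; rewrite leq_eqVlt => /orP[/eqP il|il].
  move: qy; rewrite [y]layer_bottom ?scaler0 ?eqxx //.
  by rewrite -{2}il.
have ld' : (l.+1 - i.+1 < d)%N by rewrite -ltnS (leq_trans _ ld) // subnSK.
rewrite drop_pvertices //.
have [eq|nq] := eqVneq (pstart q) (pend (pre i)); last first.
  have yi' := layer_other_vertex il yi yq nq.
  have := IH i.+1 q y ld' il yi' yq qy => sq.
  exact: subseq_trans sq (subseq_cons _ _).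
have [q0|q_gt0] := posnP (plength q).
  by rewrite (plength0 q0) /pvertices /= eq eqxx sub0seq.
have [a [q' [_ eqq vq]]] := qpath_first_arrow q_gt0.
rewrite vq /= eq eqxx.
rewrite -(path_classM _ eqq) -scalerA in qy.
apply: (IH _ _ _ ld' il _ _ qy) => //.
  by apply: (layer_jacobson il _ yi); apply: path_class_jacobson.
rewrite scalerA vclassMpath; case: pcompP eqq => // w -> _ _ _ _.
by rewrite eqxx.
Qed.

Lemma nonroute_annihilates q : nonroute p q -> pc q *: x = 0.
Proof.
move=> [eq nr]; apply/eqP/negPn/negP => qx; apply: nr; split=> //.
have := @path_nonzero_subseq 0 q x isT (layer_top x).
by rewrite drop0; apply; rewrite // eq.
Qed.

Lemma mast_generates y : exists a, y = a *: x.
Proof.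
have [a ->] := layer_cyclic (leq0n _) (layer_top y).
by exists a; rewrite prefix_path0 x_start.
Qed.

Lemma radical_layer y : y \in @radical_module _ U -> y \in layer 1.
Proof.
rewrite inE => /asboolP[n [a [z [Ja ->]]]]; apply: rpred_sum => i _.
exact: layer_jacobson (Ja i) (layer_top _).
Qed.

Lemma radical_finitely_generated : (0 < l)%N ->
  finitely_generated (submodule_type (@radical_module _ U)).
Proof.
move=> l_gt0; have Ju : pc (pre 1) *: x \in @radical_module _ U.
  rewrite inE; apply/asboolP; exists 1%N, (fun=> pc (pre 1)), (fun=> x).
  split=> [_|]; last by rewrite big_ord1.
  by apply: path_class_jacobson; rewrite ?plength_prefix.
exists 1%N, (fun=> Sub (pc (pre 1) *: x) Ju) => y.
have [a ea] := layer_cyclic l_gt0 (radical_layer (valP y)).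
exists (fun=> a); rewrite big_ord1; apply: val_inj; rewrite ea.
by rewrite -[RHS]/(submodule_incl (@radical_module _ U) (_ *: _)) linearZ.
Qed.

(** By [path_nonzero_subseq] for the trivial path, a nonzero element of JU
    living at e(1) makes e(1) one of e(2), ..., e(l+1). *)
Lemma radical_start_vertex y : ~ starts_with_oriented_cycle p ->
  y \in @radical_module _ U -> vclass (pstart p) *: y = 0.
Proof.
move=> acyc Jy; apply/eqP/negPn/negP => ey; apply: acyc.
have := @path_nonzero_subseq 1 (trivial_path (pstart p))
  (vclass (pstart p) *: y).
have ee : vclass (pstart p) * vclass (pstart p) = vclass (pstart p).
  by rewrite vclassMpath eqxx.
rewrite scalerA ee => /(_ isT (rpredZ _ (radical_layer Jy)) erefl ey).
rewrite /pvertices /= drop0 sub1seq => /(nthP (pstart p))[i].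
rewrite size_map => il ei.
exists (pre i.+1); first exact: prefix_right_subpath.
split; first by rewrite plength_prefix.
rewrite -[LHS]ei; have := @drop_pvertices _ p i.+1 il.
rewrite /pvertices /= (drop_nth (pstart p)) ?size_map //.
by case.
Qed.

End MastedModule.

(** * Irreducibility of the radical embedding *)

Section RadicalEmbedding.
Variables (K : fieldType) (G : quiver).
Variable I : two_sided_ideal (path_algebra K G).
Hypothesis I_admissible : admissible I.
Local Notation Lambda := (quotient_ring I).
Local Notation cls := (quotient_class I).
Local Notation J := (@jacobson_radical Lambda).
Local Notation pc := (path_class I).
Local Notation vclass v := (path_class I (trivial_path v)).
Variables (U : lmodType Lambda) (p : qpath G).
Local Notation e := (vclass (pstart p)).

Lemma mast_witness : mast U p -> exists (c : nat -> submodClosed U) (x : U),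
  [/\ composition_series (plength p).+1 c, e *: x = x & pc p *: x != 0].
Proof.
move=> [[c series] [x px]]; exists c, (e *: x).
have pe : pc p * e = pc p by rewrite pathMvclass eqxx.
by split; rewrite // scalerA ?pe // vclassMpath eqxx.
Qed.

Variables (c : nat -> submodClosed U) (x : U).
Hypothesis c_series : composition_series (plength p).+1 c.
Hypothesis x_start : e *: x = x.
Hypothesis px_neq0 : pc p *: x != 0.

Lemma mast_radical_annihilates j : j \in J -> j *: (pc p *: x) = 0.
Proof.
move=> Jj; apply: (layer_bottom c_series).
apply: (layer_jacobson c_series (leqnn _) Jj).
have := prefix_layer I_admissible c_series x (leqnn (plength p)).
by rewrite prefix_path_full.
Qed.

(** Modulo Jp, which kills x, the element b p is a scalar multiple of p. *)
Lemma annihilator_in_mast_radical b :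
  b * pc p *: x = 0 -> exists2 j, j \in J & b * pc p = j * pc p.
Proof.
have [k Jk] := vertex_scalar_mod_jacobson I_admissible b (pend p).
set j := _ - _ in Jk => bpx.
have ebp : b * pc p = cls (k *: path_elt p) + j * pc p.
  rewrite -(vertex_scaleM I k (erefl (pend p))) -mulrDl addrC subrK.
  by rewrite -mulrA vclassMpath eqxx.
exists j => //; rewrite ebp; have [->|k0] := eqVneq k 0.
  by rewrite scale0r class0 add0r.
case/negP: px_neq0; move: bpx; rewrite ebp scalerDl -[j * _ *: _]scalerA.
rewrite mast_radical_annihilates // addr0 => kpx.
have := @vertex_scale_inv _ _ _ _ (c 0) k p x k0.
have [bot _ _] := c_series.
by rewrite !bot; apply; rewrite kpx.
Qed.

(** An element of Lambda e is a multiple of e modulo J; a nonzero multiple of e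
    sends x outside of [layer 1], while J sends x into it. *)
Lemma annihilator_jacobson m : m * e = m -> m *: x = 0 -> m \in J.
Proof.
move=> em mx; have [k] := vertex_scalar_mod_jacobson I_admissible m (pstart p).
rewrite em; have [->|k0] := eqVneq k 0; first by rewrite scale0r class0 subr0.
move=> Jk; exfalso.
have x1 : x \in c (plength p).
  have := layer_jacobson c_series (leq0n _) Jk (layer_top c_series x).
  rewrite subSS subn0 scalerBl mx sub0r submod_opp.
  by move/(vertex_scale_inv k0); rewrite x_start.
have := prefix_notin_layer I_admissible c_series px_neq0 (leq0n (plength p)).
by rewrite prefix_path0 x_start subSS subn0 x1.
Qed.

Hypothesis U_nonsimple : ~ simple_module U.
Hypothesis p_acyclic_start : ~ starts_with_oriented_cycle p.
Hypothesis JU_irreducible :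
  irreducible_map (submodule_incl (@radical_module _ U)).

(** The dichotomy of [irreducible_inclusion_pushout], with r = p: its first case
    contradicts px <> 0 because e JU = 0, and its second case shows that the
    annihilator M of x in Lambda e satisfies M (1 + m) inside Lambda p for some
    nilpotent m in M. *)
Lemma annihilator_in_mast_ideal a : a * e = a -> a *: x = 0 ->
  exists b, a = b * pc p.
Proof.
move=> ae ax.
have l_gt0 : (0 < plength p)%N.
  rewrite lt0n; apply/eqP => l0; apply: U_nonsimple.
  by apply: simple_of_length1; exists c; rewrite -l0.
have JUfg := radical_finitely_generated I_admissible c_series px_neq0 l_gt0.
have eJU := radical_start_vertex I_admissible c_series px_neq0 p_acyclic_start.
have pe : pc p * e = pc p by rewrite pathMvclass eqxx.
have ee : e * e = e by rewrite vclassMpath eqxx.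
have Jpx : pc p *: x \in @radical_module _ U.
  rewrite inE; apply/asboolP; exists 1%N, (fun=> pc p), (fun=> x).
  by split=> [_|]; rewrite ?big_ord1 // path_class_jacobson.
have [[w Jw pw]|[f [w [Jw fxw fP]]]] :=
  irreducible_inclusion_pushout JU_irreducible JUfg Jpx.
  by case/negP: px_neq0; rewrite -pw -pe -scalerA eJU // scaler0.
(* Replacing f by e f e removes w, as e JU = 0, and keeps M f inside
   Lambda p, as a e = a on M and p e = p. *)
have efx : (e * f) *: x = x.
  have := congr1 ( *:%R e) fxw.
  by rewrite scalerDr (eJU _ Jw) addr0 x_start scalerA.
set m := e * f * e - e.
have me : m * e = m by rewrite mulrBl ee -[e * f * e * e]mulrA ee.
have mx : m *: x = 0.
  by rewrite scalerBl -[(_ * e) *: x]scalerA x_start efx subrr.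
have Jm := annihilator_jacobson me mx.
suff : a \in ideal_mul (@whole_ring Lambda) (pc p : Lambda^o).
  by rewrite inE => /asboolP[b _ ->]; exists b.
apply: (@unipotent_absorb _ (annihilator_of e x) _ m) => //.
- by rewrite inE; apply/andP; split; apply/eqP.
- exact: (jacobson_nilpotent I_admissible).
- move=> b; rewrite inE => /andP[/eqP be /eqP bx].
  have [b' eb'] := fP _ bx.
  rewrite inE; apply/asboolP; exists b' => //.
  rewrite mulrBr be addrC subrK mulrA mulrA be eb'.
  by rewrite -mulrA pe.
- by rewrite inE; apply/andP; split; apply/eqP.
Qed.

Lemma annihilator_mast a : a * e = a -> a *: x = 0 ->
  exists2 j, j \in J & a = j * pc p.
Proof.
move=> ae ax; have [b eb] := annihilator_in_mast_ideal ae ax.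
by rewrite eb; apply: annihilator_in_mast_radical; rewrite -eb.
Qed.

Lemma detour_inessential (a : arrow G) (u : qpath G) :
  detour p a u -> inessential I p a u.
Proof.
move=> [up [w ew _] [v [vp lv _]]].
have [ul eu] := right_subpath_prefix up.
have [vl _] := right_subpath_prefix vp.
have [sw tw] : pstart w = pstart p /\ pend w = atarget a.
  case: pcompP ew => // w' _ s t _ [<-].
  by rewrite s (right_subpath_start up).
have lu : (plength u < plength p)%N by rewrite (leq_trans _ vl) // -addn1.
have wx : pc w *: x \in c ((plength p).+1 - (plength u).+1).
  rewrite -(path_classM I ew) -scalerA.
  apply: (layer_jacobson c_series (ltnW lu)).
    exact: path_class_jacobson.
  by rewrite eu plength_prefix //; apply: prefix_layer.
have wv : vclass (atarget a) *: (pc w *: x) = pc w *: x.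
  by rewrite scalerA vclassMpath tw eqxx.
have [t ct et] := layer_span I_admissible c_series px_neq0
  (ltnW lu : _.+1 <= _.+1)%N wx wv.
(* All paths in t start where p does. *)
have et' : cls t * e = cls t.
  rewrite -classM; congr (cls _).
  rewrite {1}[t]path_algebraE mulr_suml [RHS]path_algebraE !big_seq.
  apply: eq_bigr => q /ct[/right_subpath_start sq _ _].
  by rewrite path_scaleAl path_eltM /path_prod pcomp_trivr sq eqxx.
have [||j Jj ej] := @annihilator_mast (pc w - cls t).
- by rewrite mulrBl et' pathMvclass sw eqxx.
- by rewrite scalerBl et subrr.
have [z z1 ez] := jacobsonP I_admissible j Jj.
exists (z * path_elt p), t; split.
- have cp : combination_of (fun q => plength p <= plength q)%N
      (path_elt p : path_algebra K G).
    exact: combination_elt.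
  (* The paths in z p are longer than p, hence visit too many vertices. *)
  apply: combination_sub _ (combination_lengthM z1 cp) => q.
  rewrite add1n => lq.
  move=> [_ /size_subseq]; rewrite /pvertices /= !size_map ltnS.
  by rewrite leqNgt lq.
- by apply: combination_sub _ ct => q [qp lq tq]; split.
- rewrite classD (classM I z) -ez -[quotient_class I (path_elt p)]/(pc p) -ej.
  by rewrite subrK path_eltM /path_prod ew.
Qed.

Lemma nonroute_in_mast_radical q : nonroute p q ->
  exists2 j, j \in J & pc q = j * pc p.
Proof.
move=> nq; apply: annihilator_mast; first by rewrite pathMvclass nq.1 eqxx.
exact: (nonroute_annihilates I_admissible c_series x_start px_neq0 nq).
Qed.

Local Notation Le := (ideal_mul (@whole_ring Lambda) (e : Lambda^o)).
Local Notation Jp := (ideal_mul (@jacobson_radical Lambda) (pc p : Lambda^o)).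

(** The map a |-> a x from Lambda e onto U, whose kernel is Jp. *)
Definition mast_evaluation (b : submodule_type Le) : U := (val b : Lambda) *: x.

Fact mast_evaluation_linear : linear mast_evaluation.
Proof.
move=> a b d; rewrite /mast_evaluation.
rewrite -[val (a *: b + d)]/(submodule_incl Le (a *: b + d)) linearP.
by rewrite scalerDl -scalerA.
Qed.

HB.instance Definition _ := GRing.isLinear.Build Lambda (submodule_type Le) U
  *:%R mast_evaluation mast_evaluation_linear.

Lemma mast_evaluation_kernel b :
  (b \in submodule_trace Le Jp) = (mast_evaluation b == 0).
Proof.
rewrite inE [LHS]inE /mast_evaluation; apply/asboolP/eqP => [[j Jj ->]|bx].
  by rewrite -[LHS]scalerA; apply: mast_radical_annihilates.
have [|j Jj ej] := annihilator_mast _ bx; last by exists j.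
have := valP b; rewrite inE => /asboolP[d _ ->].
by rewrite -[_ *: _]/(d * e) -mulrA vclassMpath eqxx.
Qed.

Lemma mast_quotient_isomorphic : isomorphic_modules U (mast_quotient I p).
Proof.
apply: (quotient_isomorphism (f := mast_evaluation)).
  exact: mast_evaluation_kernel.
move=> y; have [a ->] := mast_generates I_admissible c_series x_start px_neq0 y.
have Lae : a * e \in Le by rewrite inE; apply/asboolP; exists a.
exists (Sub (a * e) Lae : submodule_type Le).
by rewrite /= /mast_evaluation /= -scalerA x_start.
Qed.
End RadicalEmbedding.

Theorem theorem3p5 (K : fieldType) (G : quiver)
  (I : two_sided_ideal (path_algebra K G)) (I_admissible : admissible I)
  (U : lmodType (quotient_ring I)) (U_fg : finitely_generated U)
  (U_uniserial : uniserial U) (U_nonsimple : ~ simple_module U)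
  (p : qpath G) (p_mast : mast U p)
  (p_acyclic_start : ~ starts_with_oriented_cycle p)
  (JU_irreducible : irreducible_map (submodule_incl (@radical_module _ U))) :
  (forall (a : arrow G) (u : qpath G), detour p a u -> inessential I p a u) /\
  (forall q : qpath G, nonroute p q ->
     exists2 j : quotient_ring I,
       j \in @jacobson_radical (quotient_ring I) &
       path_class I q = j * path_class I p) /\
  isomorphic_modules U (mast_quotient I p).
Proof.
have [c [x [series ex px]]] := mast_witness p_mast.
split; first exact: (detour_inessential I_admissible series ex px).
split; first exact: (nonroute_in_mast_radical I_admissible series ex px).
exact: (mast_quotient_isomorphic I_admissible series ex px).
Qed.
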